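(* Let $G_3=\langle x,y\mid (yx)^2(xy)^2,\ (xy^{-1})^2(xy)^2\rangle$, and let $B(r)\subseteq G_3$ be the word ball of radius $r$ centred at $1$ with respect to the generators $x,y$. Then $\mathbb F_2[G_3]$ has a nontrivial unit $\alpha$ with $\operatorname{supp}\alpha\subseteq B(4)$, $\operatorname{supp}\alpha^{-1}\subseteq B(4)$ and $|\operatorname{supp}\alpha|+|\operatorname{supp}\alpha^{-1}|=58$. Moreover $r_{\mathrm u}(G_3)=4$.
   Context: $B(r)$ is the set of elements expressible as words of length at most $r$ in $x^{\pm1},y^{\pm1}$. The support of an element of $\mathbb F_2[G_3]$ is the finite set of group elements with nonzero coefficient. A unit of $\mathbb F_2[G_3]$ is trivial if it is a group element (support of size $1$), and nontrivial otherwise. The unit localization radius is $$r_{\mathrm u}(G_3)=\min\{r : \mathbb F_2[G_3]\text{ has a nontrivial unit } \alpha \text{ with } \operatorname{supp}\alpha,\ \operatorname{supp}\alpha^{-1}\subseteq B(r)\}.$$ *)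

(* Defs.v *)
From HB Require Import structures.
From mathcomp Require Import all_boot all_algebra.
From mathcomp Require Import generic_quotient finmap boolp.
From mathcomp Require Import monalg.

Set Implicit Arguments.
Unset Strict Implicit.
Unset Printing Implicit Defensive.

Import GRing.Theory.

Local Open Scope ring_scope.
Local Open Scope quotient_scope.

(* The letter (i, false) stands for the generator i, (i, true) for its inverse. *)
Notation word I := (seq (I * bool)).

Section Words.
Variables (I : choiceType) (rels : seq (word I)).
Implicit Types u v w : word I.

Definition letter_inv (a : I * bool) : I * bool := (a.1, ~~ a.2).
Definition word_inv w : word I := rev (map letter_inv w).

Inductive word_equiv : word I -> word I -> Prop :=
| WordRefl w : word_equiv w w
| WordSym u v : word_equiv u v -> word_equiv v u
| WordTrans u v w : word_equiv u v -> word_equiv v w -> word_equiv u w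
| WordCancel u v a : word_equiv (u ++ [:: a; letter_inv a] ++ v) (u ++ v)
| WordRel u v r : r \in rels -> word_equiv (u ++ r ++ v) (u ++ v).

Definition word_eqb u v : bool := `[< word_equiv u v >].

Lemma word_eqb_refl : reflexive word_eqb.
Proof. by move=> w; apply/asboolP; constructor. Qed.

Lemma word_eqb_sym : symmetric word_eqb.
Proof.
by move=> u v; apply/asboolP/asboolP => h; apply: WordSym.
Qed.

Lemma word_eqb_trans : transitive word_eqb.
Proof.
move=> v u w /asboolP uv /asboolP vw; apply/asboolP; exact: WordTrans uv vw.
Qed.

Canonical word_equiv_rel :=
  EquivRel word_eqb word_eqb_refl word_eqb_sym word_eqb_trans.

Definition presented := {eq_quot word_eqb}.

HB.instance Definition _ := Choice.on presented.
HB.instance Definition _ := Quotient.on presented.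
HB.instance Definition _ := EqQuotient.on presented.

Definition word_class w : presented := \pi_presented%qT w.

Lemma word_classP u v : word_class u = word_class v <-> word_equiv u v.
Proof.
split=> [/eqmodP /asboolP //|h]; by apply/eqmodP/asboolP.
Qed.

Lemma word_equiv_catl w u v : word_equiv u v -> word_equiv (w ++ u) (w ++ v).
Proof.
elim=> {u v} [u|u v _|u v x _ + _|u v a|u v r rr].
- exact: WordRefl.
- exact: WordSym.
- exact: WordTrans.
- by rewrite !(catA w); apply: WordCancel.
- by rewrite !(catA w); apply: WordRel.
Qed.

Lemma word_equiv_catr w u v : word_equiv u v -> word_equiv (u ++ w) (v ++ w).
Proof.
elim=> {u v} [u|u v _|u v x _ + _|u v a|u v r rr].
- exact: WordRefl.
- exact: WordSym.
- exact: WordTrans.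
- by rewrite -!catA; apply: WordCancel.
- by rewrite -!catA; apply: WordRel.
Qed.

Lemma letter_invK : involutive letter_inv.
Proof. by case=> i b; rewrite /letter_inv /= negbK. Qed.

Lemma word_invK : involutive word_inv.
Proof.
by move=> w; rewrite /word_inv map_rev revK mapK //; apply: letter_invK.
Qed.

Lemma word_inv_cat u v : word_inv (u ++ v) = word_inv v ++ word_inv u.
Proof. by rewrite /word_inv map_cat rev_cat. Qed.

Lemma word_equiv_catV w : word_equiv (w ++ word_inv w) [::].
Proof.
elim/last_ind: w => [|w a IH]; first exact: WordRefl.
rewrite -cats1 word_inv_cat -catA; apply: WordTrans IH.
exact: (WordCancel w (word_inv w) a).
Qed.

Lemma word_equiv_catVl w : word_equiv (word_inv w ++ w) [::].
Proof. by have := word_equiv_catV (word_inv w); rewrite word_invK. Qed.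

Lemma word_equiv_inv u v : word_equiv u v -> word_equiv (word_inv u) (word_inv v).
Proof.
move=> uv; apply: (@WordTrans _ (word_inv u ++ v ++ word_inv v)).
  apply: WordSym; rewrite -[X in word_equiv _ X]cats0.
  exact/word_equiv_catl/word_equiv_catV.
rewrite catA -[X in word_equiv _ X]cat0s; apply: word_equiv_catr.
apply: WordTrans (word_equiv_catVl u).
by apply: word_equiv_catl; apply: WordSym.
Qed.

Definition presented_one : presented := word_class [::].
Definition presented_mul (g h : presented) : presented :=
  word_class (repr g ++ repr h).
Definition presented_inv (g : presented) : presented :=
  word_class (word_inv (repr g)).

Lemma word_classK (g : presented) : word_class (repr g) = g.
Proof. exact: reprK. Qed.

Lemma word_class_cat u v :
  word_class (u ++ v) = presented_mul (word_class u) (word_class v).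
Proof.
apply/word_classP/WordSym; apply: (@WordTrans _ (u ++ repr (word_class v))).
  by apply: word_equiv_catr; apply/word_classP; rewrite word_classK.
by apply: word_equiv_catl; apply/word_classP; rewrite word_classK.
Qed.

Lemma word_class_inv u : word_class (word_inv u) = presented_inv (word_class u).
Proof.
apply/word_classP/word_equiv_inv/word_classP.
by rewrite word_classK.
Qed.

Lemma presented_mulA : associative presented_mul.
Proof.
move=> f g h; rewrite -[f]word_classK -[g]word_classK -[h]word_classK.
by rewrite -!word_class_cat catA.
Qed.

Lemma presented_mul1 : left_id presented_one presented_mul.
Proof. by move=> g; rewrite -[g]word_classK -word_class_cat. Qed.

Lemma presented_mulr1 : right_id presented_one presented_mul.
Proof. by move=> g; rewrite -[g]word_classK -word_class_cat cats0. Qed.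

Lemma presented_mulVg : left_inverse presented_one presented_inv presented_mul.
Proof.
move=> g; rewrite -[g]word_classK -word_class_inv -word_class_cat.
exact/word_classP/word_equiv_catVl.
Qed.

Lemma presented_mulgV : right_inverse presented_one presented_inv presented_mul.
Proof.
move=> g; rewrite -[g]word_classK -word_class_inv -word_class_cat.
exact/word_classP/word_equiv_catV.
Qed.

HB.instance Definition _ := isGroup.Build presented
  presented_mulA presented_mul1 presented_mulr1 presented_mulVg presented_mulgV.

Definition presented_gen (i : I) : presented := word_class [:: (i, false)].

Lemma presented_genV i : (presented_gen i)^-1%g = word_class [:: (i, true)].
Proof. exact: esym (word_class_inv [:: (i, false)]). Qed.

Lemma word_class1 : word_class [::] = 1%g. Proof. by []. Qed.

Lemma word_classM u v : word_class (u ++ v) = (word_class u * word_class v)%g.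
Proof. exact: word_class_cat. Qed.

Lemma word_classV u : word_class (word_inv u) = (word_class u)^-1%g.
Proof. exact: word_class_inv. Qed.

Lemma word_class_rel r : r \in rels -> word_class r = 1%g.
Proof.
move=> rr; rewrite -word_class1; apply: (proj2 (word_classP _ _)).
by have := WordRel [::] [::] rr; rewrite /= cats0.
Qed.

End Words.

Section GroupRing.
Variables (R : nzRingType) (G : groupType).

(* monalg only multiplies over monomial monoids, whose only invertible element
   is 1, so the convolution product over a group is defined here. *)
Definition group_ring := {malg R[G]}.

HB.instance Definition _ := Choice.on group_ring.
HB.instance Definition _ := GRing.Zmodule.on group_ring.

Implicit Types a b c : group_ring.

Definition gr_one : group_ring := << 1 *g (1%g : G) >>.

Definition gr_mul a b : group_ring :=
  \sum_(g <- msupp a) \sum_(h <- msupp b) << a@_g * b@_h *g (g * h)%g >>.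

Lemma gr_mulw (d1 d2 : {fset G}) a b :
  (msupp a `<=` d1)%fset -> (msupp b `<=` d2)%fset ->
  gr_mul a b = \sum_(g <- d1) \sum_(h <- d2) << a@_g * b@_h *g (g * h)%g >>.
Proof.
move=> le1 le2; rewrite /gr_mul (big_fset_incl _ le1) /=.
  apply/eq_bigr=> g _; apply/big_fset_incl => // h _ /mcoeff_outdom ->.
  by rewrite mulr0 monalgU0.
move=> g _ /mcoeff_outdom ag; rewrite big1 // => h _.
by rewrite ag mul0r monalgU0.
Qed.

Lemma gr_mulDl : left_distributive gr_mul +%R.
Proof.
move=> a b c.
rewrite (gr_mulw (msuppD_le _ _) (fsubset_refl _)).
rewrite (gr_mulw (fsubsetUl _ (msupp b)) (fsubset_refl _)).
rewrite (gr_mulw (fsubsetUr (msupp a) _) (fsubset_refl _)).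
rewrite -big_split /=; apply/eq_bigr=> g _.
rewrite -big_split /=; apply/eq_bigr=> h _.
by rewrite mcoeffD mulrDl monalgUD.
Qed.

Lemma gr_mulDr : right_distributive gr_mul +%R.
Proof.
move=> a b c.
rewrite (gr_mulw (fsubset_refl _) (msuppD_le _ _)).
rewrite (gr_mulw (fsubset_refl _) (fsubsetUl _ (msupp c))).
rewrite (gr_mulw (fsubset_refl _) (fsubsetUr (msupp b) _)).
rewrite -big_split /=; apply/eq_bigr=> g _.
rewrite -big_split /=; apply/eq_bigr=> h _.
by rewrite mcoeffD mulrDr monalgUD.
Qed.

Lemma gr_mul0r : left_zero 0 gr_mul.
Proof. by move=> a; rewrite /gr_mul msupp0 big_seq_fset0. Qed.

Lemma gr_mulr0 : right_zero 0 gr_mul.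
Proof.
by move=> a; rewrite /gr_mul big1 // => g _; rewrite msupp0 big_seq_fset0.
Qed.

Lemma gr_mulUU (x y : R) (g h : G) :
  gr_mul << x *g g >> << y *g h >> = << x * y *g (g * h)%g >>.
Proof. by rewrite (gr_mulw msuppU_le msuppU_le) !big_seq_fset1 !mcoeffUU. Qed.

Lemma gr_mul_suml (J : Type) (s : seq J) (F : J -> group_ring) b :
  gr_mul (\sum_(j <- s) F j) b = \sum_(j <- s) gr_mul (F j) b.
Proof.
exact: (big_morph (gr_mul^~ b) (fun _ _ => gr_mulDl _ _ _) (gr_mul0r _)).
Qed.

Lemma gr_mul_sumr (J : Type) (s : seq J) (F : J -> group_ring) a :
  gr_mul a (\sum_(j <- s) F j) = \sum_(j <- s) gr_mul a (F j).
Proof.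
exact: (big_morph (gr_mul a) (fun _ _ => gr_mulDr _ _ _) (gr_mulr0 _)).
Qed.

Lemma gr_mulA : associative gr_mul.
Proof.
move=> a b c; rewrite [a]monalgE [b]monalgE [c]monalgE.
rewrite [LHS]gr_mul_suml [X in _ = gr_mul X _]gr_mul_suml [RHS]gr_mul_suml.
apply/eq_bigr=> g _.
rewrite [X in gr_mul _ X = _]gr_mul_suml [LHS]gr_mul_sumr.
rewrite [X in _ = gr_mul X _]gr_mul_sumr [RHS]gr_mul_suml.
apply/eq_bigr=> h _.
rewrite [X in gr_mul _ X = _]gr_mul_sumr [LHS]gr_mul_sumr [RHS]gr_mul_sumr.
apply/eq_bigr=> k _.
by rewrite !gr_mulUU mulrA mulgA.
Qed.

Lemma gr_mul1r : left_id gr_one gr_mul.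
Proof.
move=> a; rewrite [a]monalgE gr_mul_sumr; apply/eq_bigr=> g _.
by rewrite gr_mulUU mul1r mul1g.
Qed.

Lemma gr_mulr1 : right_id gr_one gr_mul.
Proof.
move=> a; rewrite [a]monalgE gr_mul_suml; apply/eq_bigr=> g _.
by rewrite gr_mulUU mulr1 mulg1.
Qed.

Lemma gr_oner_neq0 : gr_one != 0.
Proof. by rewrite monalgU_eq0 oner_eq0. Qed.

HB.instance Definition _ := GRing.Zmodule_isNzRing.Build group_ring
  gr_mulA gr_mul1r gr_mulr1 gr_mulDl gr_mulDr gr_oner_neq0.

Definition gr_invertible a : Prop := exists b, b * a = 1 /\ a * b = 1.

Definition gr_unit : pred group_ring := fun a => `[< gr_invertible a >].

Definition gr_inv a : group_ring :=
  if pselect (gr_invertible a) is left ex then projT1 (cid ex) else a.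

Lemma gr_mulVr : {in gr_unit, left_inverse 1 gr_inv *%R}.
Proof.
move=> a /asboolP ua; rewrite /gr_inv; case: pselect => // ex.
by case: cid => b [].
Qed.

Lemma gr_divrr : {in gr_unit, right_inverse 1 gr_inv *%R}.
Proof.
move=> a /asboolP ua; rewrite /gr_inv; case: pselect => // ex.
by case: cid => b [].
Qed.

Lemma gr_unitP a b : b * a = 1 /\ a * b = 1 -> gr_unit a.
Proof. by move=> h; apply/asboolP; exists b. Qed.

Lemma gr_inv_out : {in [predC gr_unit], gr_inv =1 id}.
Proof.
move=> a /negP ua; rewrite /gr_inv; case: pselect => // ex.
by case: ua; apply/asboolP.
Qed.

HB.instance Definition _ := GRing.NzRing_hasMulInverse.Build group_ring
  gr_mulVr gr_divrr gr_unitP gr_inv_out.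

Definition supp a : {fset G} := msupp (a : {malg R[G]}).

Definition gr_of (g : G) : group_ring := << (1 : R) *g g >>.

End GroupRing.

Section UnitLocalization.
Variables (G : groupType) (S : seq G).

Definition word_ball (r : nat) (g : G) : Prop :=
  exists s : seq G,
    [/\ (size s <= r)%N, all (fun a => (a \in S) || (a^-1%g \in S)) s
      & g = (\prod_(a <- s) a)%g].

Definition supp_in_ball (r : nat) (a : group_ring 'F_2 G) : Prop :=
  forall g, g \in supp a -> word_ball r g.

Definition trivial_unit (a : group_ring 'F_2 G) : Prop :=
  exists g : G, a = gr_of 'F_2 g.

Definition nontrivial_unit (a : group_ring 'F_2 G) : Prop :=
  a \is a GRing.unit /\ ~ trivial_unit a.

Definition has_nontrivial_unit_within (r : nat) : Prop :=
  exists a : group_ring 'F_2 G,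
    [/\ nontrivial_unit a, supp_in_ball r a & supp_in_ball r a^-1].

Definition is_unit_localization_radius (r : nat) : Prop :=
  has_nontrivial_unit_within r /\
  forall s : nat, has_nontrivial_unit_within s -> (r <= s)%N.

End UnitLocalization.

(* The two generators x and y are indexed by false and true. *)
Section G3.

Let x : word bool := [:: (false, false)].
Let y : word bool := [:: (true, false)].
Let Y : word bool := word_inv y.

Definition G3_relators : seq (word bool) :=
  [:: (y ++ x) ++ (y ++ x) ++ (x ++ y) ++ (x ++ y);
      (x ++ Y) ++ (x ++ Y) ++ (x ++ y) ++ (x ++ y)].

End G3.

Definition G3 : groupType := presented G3_relators.
Definition G3x : G3 := presented_gen G3_relators false.
Definition G3y : G3 := presented_gen G3_relators true.

(* Main.v *)
(** The group has the normal form x^(2i) y^(2j) c^k t with c = (xy)^2 and t in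
    {1, x, y, xy}: c is inverted by x and y, and [y^2, x^2] = c^4, so G_3 is a
    Nil crystallographic group whose word problem is decided by right
    multiplication on such quadruples.  There is a unit of support size 29 in B(4)
    whose inverse is obtained from it by exchanging x and y.

    For the lower bound, write A and B for the supports of a unit and of its inverse,
    inside the 53 elements of B(3).  Each element of the group gives an equation over
    F_2 between the products A(u) B(v).  The equations are preserved by the eight
    signed permutations of x, y, by inversion and by the exchange of A and B, so as
    soon as one element is excluded from all supports, its whole orbit is.  Starting
    from xxy, then xyx^-1, then xyx, unit propagation with a few case distinctions
    excludes every element but 1, hence only trivial units remain. *)

Require Import Defs.
From mathcomp Require Import all_boot all_algebra finmap.
From mathcomp Require Import generic_quotient monalg zify.

Set Implicit Arguments.
Unset Strict Implicit.
Unset Printing Implicit Defensive.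

Import GRing.Theory.

Local Notation wclass := (word_class G3_relators).

(** * Normal form *)

Section IntegerPowers.
Variable G : groupType.
Implicit Types (z w : G) (m n : int).
Local Open Scope group_scope.

(* Locked, as otherwise [mulgA] sees a power with a literal exponent as a product. *)
Definition zpow z n : G :=
  locked match n with Posz n => z ^+ n | Negz n => z^-1 ^+ n.+1 end.

Lemma zpow0 z : zpow z 0%R = 1. Proof. by rewrite /zpow -lock. Qed.
Lemma zpow1 z : zpow z 1%R = z. Proof. by rewrite /zpow -lock. Qed.
Lemma zpowN1 z : zpow z (-1)%R = z^-1. Proof. by rewrite /zpow -lock. Qed.

Lemma zpowS z n : zpow z (n + 1)%R = zpow z n * z.
Proof.
rewrite /zpow -!lock; case: n => [n|[|n]]; first by rewrite -PoszD addn1 expgSr.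
  by rewrite /= mulVg.
have -> : (Negz n.+1 + 1)%R = Negz n by lia.
by rewrite [in RHS]expgSr mulgVK.
Qed.

Lemma zpowB1 z n : zpow z (n - 1)%R = zpow z n * z^-1.
Proof. by rewrite -[in RHS](subrK 1%R n) zpowS mulgK. Qed.

(** The predicate also takes the power itself, so that [elim] puts $z^n z$ or $z^n z^{-1}$ into the
    goal in place of the power, with a step in each direction from every integer. *)
Lemma zpow_ind z (P : int -> G -> Prop) :
  P 0%R 1 -> (forall n, P n (zpow z n) -> P (n + 1)%R (zpow z n * z)) ->
  (forall n, P n (zpow z n) -> P (n - 1)%R (zpow z n * z^-1)) ->
  forall n, P n (zpow z n).
Proof.
move=> P0 PS PP; elim/int_ind=> [|n IH|n IH]; first by rewrite zpow0.
  by rewrite -addn1 PoszD zpowS; apply: PS.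
by rewrite -addn1 PoszD opprD zpowB1; apply: PP.
Qed.

Lemma zpowD z m n : zpow z (m + n)%R = zpow z m * zpow z n.
Proof.
elim/zpow_ind: n / (zpow z n) => [|n IH|n IH]; rewrite ?addr0 ?mulg1 // addrA mulgA.
  by rewrite zpowS IH.
by rewrite zpowB1 IH.
Qed.

Lemma zpow2 z : zpow z 2%R = z * z. Proof. by rewrite (zpowD z 1%R 1%R) zpow1. Qed.

Lemma commute_zpow z w n : commute w z -> commute w (zpow z n).
Proof. by rewrite /zpow -lock; case: n => n cwz; apply: commuteX => //; apply: commuteV. Qed.

End IntegerPowers.

(* The quadruple [(i, j, k, (a, b))] stands for [x^(2i) y^(2j) c^k x^a y^b], where
   [c = (xy)^2]; the letter [(g, s)] is [y] or [x] according to [g], inverted if [s]. *)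
Definition nform : Type := (int * int * int * (bool * bool))%type.

Definition norigin : nform := (0, 0, 0, (false, false))%R.

Definition nstep (g : nform) (a : bool * bool) : nform :=
  let: (i, j, k, t) := g in
  match a, t with
  | (false, false), (false, false) => (i, j, k, (true, false))
  | (false, false), (true, false) => (i + 1, j, k + 4 * j, (false, false))
  | (false, false), (false, true) => (i - 1, j + 1, k - 3 - 4 * j, (true, true))
  | (false, false), (true, true) => (i, j - 1, k + 1, (false, true))
  | (false, true), (true, false) => (i, j, k, (false, false))
  | (false, true), (false, false) => (i - 1, j, k - 4 * j, (true, false))
  | (false, true), (true, true) => (i + 1, j - 1, k - 1 + 4 * j, (false, true))
  | (false, true), (false, true) => (i, j + 1, k - 1, (true, true))
  | (true, false), (false, false) => (i, j, k, (false, true))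
  | (true, false), (true, false) => (i, j, k, (true, true))
  | (true, false), (false, true) => (i, j + 1, k, (false, false))
  | (true, false), (true, true) => (i, j - 1, k + 2, (true, false))
  | (true, true), (false, true) => (i, j, k, (false, false))
  | (true, true), (true, true) => (i, j, k, (true, false))
  | (true, true), (false, false) => (i, j - 1, k, (false, true))
  | (true, true), (true, false) => (i, j + 1, k - 2, (true, true))
  end%R.

Ltac nform_eq := congr (_, _, _, _); lia.

(** Each letter thus permutes the quadruples. As the relators fix every quadruple by
    [foldl_nstep_rel], this is a right action of $G_3$, so the normal form depends only on the class
    of a word; no group law on quadruples is required. *)
Lemma nstepK a : cancel (nstep^~ a) (nstep^~ (letter_inv a)).
Proof. by case: a => [[] []] [[[i j] k] [[] []]] //=; nform_eq. Qed.

Lemma foldl_nstep_rel g r : r \in G3_relators -> foldl nstep g r = g.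
Proof.
rewrite !inE => /orP[] /eqP ->;
  by case: g => [[[i j] k] [[] []]] /=; nform_eq.
Qed.

(** * Evaluation of quadruples in a group satisfying the two relations *)

Section NilRelations.
Variables (G : groupType) (x y : G).
Local Open Scope group_scope.
Hypothesis rel1 : (y * x) * (y * x) * (x * y) * (x * y) = 1.
Hypothesis rel2 : (x * y^-1) * (x * y^-1) * (x * y) * (x * y) = 1.

(** [X] and [Y] are the squares of the generators, not their inverses. They are variables with
    defining equations, so that free reduction sees inside them only where an equation is
    rewritten. *)
Variables c X Y : G.
Hypotheses (cE : c = (x * y) * (x * y)) (XE : X = x * x) (YE : Y = y * y).

(** Rewriting with this tuple is free reduction of left-associated words. The basic relations come
    from inserting a relator into a word, checking the result by free reduction, and deleting the
    relator again. *)
Let free_reduce :=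
  (@invgM G, @invgK G, @mulgA G, @mulgK G, @mulgVK G, @mulgV G, @mulVg G, @mulg1 G, @mul1g G).

Let conj_cx : c * x = x * c^-1.
Proof.
have -> : c * x = x * ((y * x) * (y * x) * (x * y) * (x * y)) * c^-1.
  by rewrite cE !free_reduce.
by rewrite rel1 mulg1.
Qed.

Let conj_cVx : c^-1 * x = x * c.
Proof. by apply: (mulgI c); rewrite mulVKg mulgA conj_cx mulgVK. Qed.

Let conj_cy : c * y = y * c^-1.
Proof.
have -> : c * y = c * x^-1 * (x * y) by rewrite !free_reduce.
have -> : c * x^-1 = x^-1 * c^-1.
  by apply: (mulgI x); apply: (mulIg x); rewrite !mulgA -conj_cVx !free_reduce.
by rewrite cE !free_reduce.
Qed.

Let conj_cVy : c^-1 * y = y * c.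
Proof. by apply: (mulgI c); rewrite mulVKg mulgA conj_cy mulgVK. Qed.

Let commute_cX : commute c X.
Proof. by rewrite /commute XE mulgA conj_cx -!mulgA conj_cVx. Qed.

Let commute_cY : commute c Y.
Proof. by rewrite /commute YE mulgA conj_cy -!mulgA conj_cVy. Qed.

Let xyx : x * y * x = c * y^-1.
Proof. by rewrite cE !free_reduce. Qed.

Let xyV : x * y^-1 = c^-1 * y * x^-1.
Proof.
have -> : x * y^-1 = ((x * y^-1) * (x * y^-1) * (x * y) * (x * y)) * c^-1 * y * x^-1.
  by rewrite cE !free_reduce.
by rewrite rel2 mul1g.
Qed.

Let xYE : x * Y = c * c * Y^-1 * x.
Proof.
have xVy : x^-1 * y = y^-1 * c * x.
  have -> : y^-1 * c * x =
            x^-1 * y * x^-1 * ((x * y^-1) * (x * y^-1) * (x * y) * (x * y)) * x.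
    by rewrite cE !free_reduce.
  by rewrite rel2 !free_reduce.
have -> : x * Y = c * y^-1 * (x^-1 * y) by rewrite cE YE !free_reduce.
rewrite xVy -(mulgA c c) (commuteV commute_cY : c * Y^-1 = Y^-1 * c).
by rewrite YE !invgM !mulgA.
Qed.

Let xYVE : x * Y^-1 = c^-1 * c^-1 * Y * x.
Proof.
apply: (mulIg Y); rewrite mulgVK -[RHS]mulgA xYE.
rewrite -(mulgA c c) (commuteV commute_cY : c * Y^-1 = Y^-1 * c).
rewrite (mulgA c) (commuteV commute_cY : c * Y^-1 = Y^-1 * c).
by rewrite !free_reduce.
Qed.

(** Conjugation $z \mapsto xzx^{-1}$ sends $Y$ to $c^2Y^{-1}$ and $c$ to $c^{-1}$. Applied twice it
    sends $Y$ to $Yc^{-4}$, and $c$ commutes with $X$ and $Y$. *)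
Let YX_XY : Y * X = X * Y * (c * c * c * c).
Proof.
have Yx : Y * x = c * c * x * Y^-1.
  by rewrite -mulgA xYVE !free_reduce.
have YVx : Y^-1 * x = c^-1 * c^-1 * x * Y.
  by rewrite -mulgA xYE !free_reduce.
have -> : Y * X = c * (c * (x * c^-1)) * c^-1 * x * Y.
  by rewrite XE mulgA Yx -mulgA YVx !mulgA.
rewrite -conj_cx.
have -> : c * (c * (c * x)) * c^-1 * x * Y = c * c * c * (x * c^-1) * x * Y.
  by rewrite !free_reduce.
rewrite -conj_cx; have -> : c * c * c * (c * x) * x * Y = c * c * c * c * (X * Y).
  by rewrite XE !mulgA.
have cXY : commute (X * Y) c by apply/commute_sym; apply: commuteM.
by apply/esym; do !apply: commuteM.
Qed.

Let yxE : y * x = X^-1 * Y * (c^-1 * c^-1 * c^-1) * (x * y).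
Proof.
have -> : y * x = X^-1 * (x * c) * y^-1 by rewrite XE cE !free_reduce.
rewrite -conj_cVx.
have -> : X^-1 * (c^-1 * x) * y^-1 = X^-1 * c^-1 * (x * y^-1) by rewrite !mulgA.
rewrite xyV.
have -> : X^-1 * c^-1 * (c^-1 * y * x^-1) = X^-1 * (c^-1 * c^-1 * Y) * (x * y * c^-1).
  by rewrite cE YE !free_reduce.
have cY2 : commute Y (c^-1 * c^-1) by apply: commuteM; apply/commuteV/commute_sym.
rewrite -cY2.
have -> : x * y * c^-1 = c^-1 * (x * y) by rewrite cE !free_reduce.
by rewrite !mulgA.
Qed.

Let zc_comm n z : commute c z -> zpow c n * z = z * zpow c n.
Proof. by move=> cz; apply/commute_sym/commute_zpow/commute_sym. Qed.

Let c3 : c^-1 * c^-1 * c^-1 = zpow c (-3)%R.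
Proof. by rewrite (zpowD c (-2)%R (-1)%R) (zpowD c (-1)%R (-1)%R) zpowN1. Qed.

Let c4 : c * c * c * c = zpow c 4%R.
Proof. by rewrite (zpowD c 3%R 1%R) (zpowD c 2%R 1%R) (zpowD c 1%R 1%R) zpow1. Qed.

Let cXV : commute c X^-1. Proof. exact: commuteV. Qed.
Let cYV : commute c Y^-1. Proof. exact: commuteV. Qed.

Let YVX_XYV : Y^-1 * X = X * Y^-1 * zpow c (-4)%R.
Proof.
apply: (mulgI Y); rewrite mulVKg !mulgA YX_XY c4 -(mulgA (X * Y)).
rewrite (zc_comm 4%R cYV) !mulgA mulgK -mulgA -zpowD.
by rewrite subrr zpow0 mulg1.
Qed.

Let zY_X n : zpow Y n * X = X * zpow Y n * zpow c (4 * n)%R.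
Proof.
(* One step for both directions of the induction: $s = Y$ with $e = 4$, and $s = Y^{-1}$ with $e =
   -4$. *)
have step s e m : commute c s -> s * X = X * s * zpow c e ->
    zpow Y m * X = X * zpow Y m * zpow c (4 * m)%R ->
    zpow Y m * s * X = X * (zpow Y m * s) * zpow c (4 * m + e)%R.
  move=> cs sX IH; rewrite -mulgA sX !mulgA IH -!mulgA zpowD; congr (_ * (_ * _)).
  by rewrite !mulgA zc_comm.
elim/zpow_ind: n / (zpow Y n) => [|n IH|n IH].
- by rewrite mulr0 zpow0 !mulg1 mul1g.
- by rewrite mulrDr mulr1; apply: step => //; rewrite YX_XY c4.
- by rewrite mulrBr mulr1; apply: step => //; apply: commuteV.
Qed.

Let zY_XV n : zpow Y n * X^-1 = X^-1 * zpow Y n * zpow c (- (4 * n))%R.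
Proof.
apply: (mulgI X); apply: (mulIg X).
rewrite !mulgA mulgVK mulgV mul1g -mulgA (zc_comm _ commute_cX) mulgA zY_X.
by rewrite -mulgA -zpowD subrr zpow0 mulg1.
Qed.

Definition nval (g : nform) : G :=
  let: (i, j, k, (hx, hy)) := g in
  zpow X i * zpow Y j * zpow c k * ((if hx then x else 1) * (if hy then y else 1)).

Definition lval (a : bool * bool) : G :=
  let z := if a.1 then y else x in if a.2 then z^-1 else z.

Lemma nval_step g a : nval (nstep g a) = nval g * lval a.
Proof.
(* For an inverted letter, apply the claim for the generator itself to [nstep g (b, true)], which
   [nstepK] sends back to [g]. *)
wlog: g a / ~~ a.2.
  move=> IH; case: a => b [|]; last exact: IH.
  have := IH (nstep g (b, true)) (b, false) isT.
  by rewrite (nstepK (b, true)) /lval => ->; rewrite [_.1]/= [_.2]/= mulgK.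
case: a => [b []] // _; case: g => [[[i j] k] [hx hy]].
(* Where the letter merely extends $t$ nothing is left to prove. The five remaining cases are, in
   order, the products $xy\cdot y$, $y\cdot y$, $xy\cdot x$, $x\cdot x$ and $y\cdot x$. *)
case: b; case: hx; case: hy; rewrite /nval /lval /= ?mulg1 ?mul1g ?mulgA //.
- rewrite -(mulgA _ y y) -YE -(mulgA _ x Y) xYE -zpow2.
  rewrite zpowB1 zpowD -!mulgA; congr (_ * (_ * _)).
  rewrite (mulgA Y^-1) -(zc_comm k cYV) -mulgA; congr (_ * _).
  by rewrite !mulgA -(zc_comm _ cYV).
- rewrite -(mulgA _ y y) -YE -(mulgA _ _ Y) (zc_comm k commute_cY) zpowS.
  by rewrite !mulgA.
- rewrite -!mulgA (mulgA x) xyx zpowB1 zpowS -!mulgA; congr (_ * (_ * _)).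
  rewrite (mulgA Y^-1) -(zc_comm k cYV) -mulgA; congr (_ * _).
  rewrite (mulgA Y^-1) -[Y^-1 * c]cYV -mulgA; congr (_ * _).
  by rewrite YE !free_reduce.
- rewrite -(mulgA _ x x) -XE -(mulgA _ _ X) (zc_comm k commute_cX) mulgA.
  rewrite -(mulgA _ _ X) zY_X zpowS addrC zpowD.
  by rewrite !mulgA.
- rewrite -(mulgA _ y x) yxE c3 !mulgA -(mulgA _ _ X^-1) (zc_comm k cXV) mulgA.
  rewrite -(mulgA _ _ X^-1) zY_XV zpowB1 zpowS !mulgA; congr (_ * _ * _).
  rewrite -(mulgA _ _ (zpow c k)) -zpowD -(mulgA _ (zpow c _) Y) (zc_comm _ commute_cY).
  rewrite mulgA -(mulgA _ _ (zpow c (-3)%R)) -zpowD; congr (_ * zpow c _); lia.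
Qed.

End NilRelations.

Definition nf (w : word bool) : nform := foldl nstep norigin w.

Lemma foldl_nstep_equiv u v :
  word_equiv G3_relators u v -> forall g, foldl nstep g u = foldl nstep g v.
Proof.
elim=> {u v} [//|u v _ IH g|u v w _ IH1 _ IH2 g|u v a g|u v r rr g].
- by rewrite IH.
- by rewrite IH1 IH2.
- by rewrite !foldl_cat /= nstepK.
- by rewrite !foldl_cat (foldl_nstep_rel _ rr).
Qed.

Lemma word_classE w : wclass w = (\prod_(a <- w) lval G3x G3y a)%g.
Proof.
elim: w => [|a w IH]; first by rewrite big_nil.
rewrite big_cons -IH -cat1s word_classM; congr (_ * _)%g.
by case: a => [[] []]; rewrite /lval //= presented_genV.
Qed.

Lemma nvalP w :
  nval G3x G3y (G3x * G3y * (G3x * G3y))%g (G3x * G3x)%g (G3y * G3y)%g (nf w)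
  = wclass w.
Proof.
have rel r : r \in G3_relators -> (\prod_(a <- r) lval G3x G3y a)%g = 1%g.
  by rewrite -word_classE; apply: word_class_rel.
have rel1 := rel _ (mem_head _ _).
have rel2 : (\prod_(a <- nth [::] G3_relators 1) lval G3x G3y a)%g = 1%g.
  by apply: rel; apply: mem_nth.
rewrite word_classE; move: G3x G3y rel1 rel2 => x y; rewrite !big_cons !big_nil.
rewrite /lval /= !mulg1 => {rel} rel1 rel2.
have {}rel1 : ((y * x) * (y * x) * (x * y) * (x * y) = 1)%g by rewrite -!mulgA.
have {}rel2 : ((x * y^-1) * (x * y^-1) * (x * y) * (x * y) = 1)%g by rewrite -!mulgA.
elim/last_ind: w => [|w a IH]; first by rewrite /= !zpow0 !mulg1 big_nil.
by rewrite /nf foldl_rcons (nval_step rel1 rel2) // IH big_rcons.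
Qed.

(** Equal quadruples evaluate to the same element by [nvalP]; conversely, words of the same class
    act alike on [norigin]. This decides the word problem by computation. *)
Lemma nfP u v : reflect (wclass u = wclass v) (nf u == nf v).
Proof.
apply: (iffP eqP) => [e|/word_classP e]; first by rewrite -!nvalP e.
exact: foldl_nstep_equiv.
Qed.

(** * The unit *)

Section CharacteristicTwo.
Local Open Scope ring_scope.

Lemma F2_natr_addb (a b : bool) : (a (+) b)%:R = a%:R + b%:R :> 'F_2.
Proof. by case: a; case: b => //; apply/val_inj. Qed.

Lemma F2_natr_inj : injective (fun b : bool => b%:R : 'F_2).
Proof. by case=> [] []. Qed.

Lemma F2_neq0 (a : 'F_2) : a = (a != 0)%:R.
Proof. by case: a => [[|[|n]] //= ?]; apply/val_inj. Qed.

Lemma F2_natr_xor (I : Type) (s : seq I) (P F : pred I) :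
  \sum_(i <- s | P i) (F i)%:R = (\big[addb/false]_(i <- s | P i) F i)%:R :> 'F_2.
Proof. by apply/esym; apply: (big_morph (fun b : bool => b%:R : 'F_2) F2_natr_addb). Qed.

End CharacteristicTwo.

Section GroupRing.
Local Open Scope ring_scope.

Lemma eq_wclass u v : (wclass u == wclass v) = (nf u == nf v).
Proof. by apply/eqP/idP => [/nfP|/nfP]. Qed.

Definition gsum (s : seq (word bool)) : group_ring 'F_2 G3 :=
  \sum_(w <- s) gr_of 'F_2 (wclass w).

Lemma mcoeff_gsum s k :
  mcoeff (wclass k) (gsum s) = (odd (count (fun w => nf w == nf k) s))%:R.
Proof.
rewrite /gsum raddf_sum /=; elim: s => [|w s IH]; first by rewrite big_nil.
rewrite big_cons IH mcoeffU eq_wclass /= oddD F2_natr_addb.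
by case: (nf w == nf k).
Qed.

Lemma gsumM s t : gsum s * gsum t = gsum [seq u ++ v | u <- s, v <- t].
Proof.
rewrite /gsum big_allpairs_dep [LHS]gr_mul_suml; apply: eq_bigr => u _.
rewrite gr_mul_sumr; apply: eq_bigr => v _.
by rewrite word_classM /gr_of gr_mulUU mulr1.
Qed.

Lemma gr_eqP (a b : group_ring 'F_2 G3) :
  (forall k, mcoeff (wclass k) a = mcoeff (wclass k) b) -> a = b.
Proof. by move=> e; apply/malgP => g; rewrite -[g]word_classK. Qed.

Lemma mcoeff_gr_one k : mcoeff (wclass k) (1 : group_ring 'F_2 G3) = (nf k == norigin)%:R.
Proof. by rewrite mcoeffU -word_class1 eq_wclass eq_sym. Qed.

Definition is_product_one (s t : seq (word bool)) : bool :=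
  let l := [seq nf (u ++ v) | u <- s, v <- t] in
  [seq z <- undup l | odd (count_mem z l)] == [:: norigin].

Lemma gsumM_eq1 s t : is_product_one s t -> gsum s * gsum t = 1.
Proof.
rewrite /is_product_one -(map_allpairs nf); set l := [seq u ++ v | u <- s, v <- t] => /eqP e.
rewrite gsumM; apply: gr_eqP => k; rewrite mcoeff_gsum mcoeff_gr_one; congr (_%:R).
rewrite -(count_map nf (pred1 (nf k))) -/l; set m := map nf l in e *.
(* By [e], being [norigin] amounts to lying in the filtered list, that is, occurring in [m] with odd
   multiplicity. Outside [m] the multiplicity is 0. *)
have := mem_seq1 (nf k) norigin; rewrite -e mem_filter mem_undup => <-.
case: (boolP (nf k \in m)) => [|/count_memPn ->] //; by rewrite andbT.
Qed.

Lemma supp_gsum s : uniq (map nf s) ->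
  supp (gsum s) = [fset g in map wclass s]%fset.
Proof.
move=> us; apply/fsetP => g; rewrite -[g]word_classK; move: (repr g) => k.
rewrite -mcoeff_neq0 mcoeff_gsum -(count_map nf (pred1 (nf k))) count_uniq_mem //.
rewrite in_fset oddb.
have -> : (wclass k \in map wclass s) = (nf k \in map nf s).
  by apply/mapP/mapP => -[w ws e]; exists w => //; [apply/eqP/nfP | apply/nfP/eqP].
by case: (_ \in _).
Qed.

Lemma card_supp_gsum s : uniq (map nf s) -> #|` supp (gsum s)| = size s.
Proof.
move=> us; rewrite supp_gsum // card_fseq undup_id ?size_map //.
apply: (@map_uniq _ _ (fun g => nf (repr g))); rewrite -map_comp.
by rewrite (eq_map (g := nf)) // => w; apply/eqP/nfP; rewrite /= word_classK.
Qed.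

Lemma word_ball_wclass r w : (size w <= r)%N -> word_ball [:: G3x; G3y] r (wclass w).
Proof.
move=> wr; exists (map (lval G3x G3y) w); split; first by rewrite size_map.
  apply/allP => _ /mapP [[[] []] _ ->]; rewrite /lval /= ?invgK !inE eqxx ?orbT //.
by rewrite big_map word_classE.
Qed.

Lemma word_ballP r g : word_ball [:: G3x; G3y] r g ->
  exists2 w, (size w <= r)%N & g = wclass w.
Proof.
case=> s [sr /allP ls ->]; elim: s r sr ls => [|a s IH] r sr ls.
  by exists [::]; rewrite ?big_nil.
case: r sr => // r sr; case: (IH r sr) => [b sb|w wr e].
  by apply: ls; rewrite inE sb orbT.
have [l al] : exists l, a = lval G3x G3y l.
  have := ls a (mem_head _ _); rewrite !inE -orbA => /or4P[] /eqP e1.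
  - by exists (false, false).
  - by exists (true, false).
  - by exists (false, true); rewrite /lval /= -e1 invgK.
  - by exists (true, true); rewrite /lval /= -e1 invgK.
by exists (l :: w); rewrite // big_cons e al [RHS]word_classE big_cons -word_classE.
Qed.

Lemma supp_in_ball_gsum r s :
  all (fun w => size w <= r)%N s -> supp_in_ball [:: G3x; G3y] r (gsum s).
Proof.
move=> /allP sr g; rewrite -mcoeff_neq0 -[g]word_classK mcoeff_gsum => h.
have : has (fun w => nf w == nf (repr g)) s.
  by rewrite has_count; case: count h => //; rewrite eqxx.
by case/hasP=> w ws /nfP <-; apply/word_ball_wclass/sr.
Qed.

(* Found by a SAT search, assuming that exchanging x and y inverts the unit. *)
Definition unit_support : seq (word bool) :=
  let x := (false, false) in let X := (false, true) in
  let y := (true, false) in let Y := (true, true) in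
  [:: [:: x]; [:: X]; [:: y]; [:: Y];
      [:: x; y]; [:: x; Y]; [:: X; y]; [:: X; Y];
      [:: y; x]; [:: y; X]; [:: Y; x]; [:: Y; X];
      [:: x; y; x]; [:: x; y; X]; [:: x; Y; x]; [:: X; y; X]; [:: X; Y; x]; [:: X; Y; X];
      [:: y; x; y]; [:: y; x; Y]; [:: y; X; y]; [:: Y; x; Y]; [:: Y; X; y]; [:: Y; X; Y];
      [:: x; y; x; Y]; [:: x; y; X; y]; [:: x; Y; x; Y]; [:: X; Y; x; Y]; [:: X; Y; X; y]].

Definition swap_xy (a : bool * bool) := (~~ a.1, a.2).

Lemma unit_product : is_product_one unit_support (map (map swap_xy) unit_support).
Proof. by vm_compute. Qed.

Lemma unit_product_swap : is_product_one (map (map swap_xy) unit_support) unit_support.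
Proof. by vm_compute. Qed.

Lemma gsum_inv s t : is_product_one s t -> is_product_one t s ->
  gsum s \is a GRing.unit /\ (gsum s)^-1 = gsum t.
Proof.
move=> /gsumM_eq1 st /gsumM_eq1 ts.
have us : gsum s \is a GRing.unit by exact: gr_unitP (conj ts st).
by split=> //; rewrite -[LHS]mulr1 -st mulKr.
Qed.

Lemma nontrivial_gsum s : uniq (map nf s) -> (1 < size s)%N ->
  gsum s \is a GRing.unit -> nontrivial_unit (gsum s).
Proof.
move=> us s1 unit_s; split=> // -[g e]; move: s1.
by rewrite -card_supp_gsum // e /supp /gr_of msuppU oner_eq0 cardfs1.
Qed.

Lemma exists_unit :
  exists alpha : group_ring 'F_2 G3,
     [/\ nontrivial_unit alpha,
         supp_in_ball [:: G3x; G3y] 4 alpha,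
         supp_in_ball [:: G3x; G3y] 4 alpha^-1
       & (#|` supp alpha| + #|` supp alpha^-1|)%N = 58%N].
Proof.
have [us inv] := gsum_inv unit_product unit_product_swap.
have uniq1 : uniq (map nf unit_support) by vm_compute.
have uniq2 : uniq (map nf (map (map swap_xy) unit_support)) by vm_compute.
exists (gsum unit_support); rewrite inv (card_supp_gsum uniq1) (card_supp_gsum uniq2).
split=> //; [exact: nontrivial_gsum | exact: supp_in_ball_gsum ..].
Qed.

End GroupRing.

(** * Symmetries of inverse pairs in B(3) *)

Definition letters : seq (bool * bool) :=
  [:: (false, false); (false, true); (true, false); (true, true)].

Fixpoint reduced_words (n : nat) : seq (word bool) :=
  if n is n'.+1 then
    [::] :: [seq a :: w | a <- letters,
                          w <- [seq w <- reduced_words n' | ohead w != Some (letter_inv a)]]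
  else [:: [::]].

Definition ball3 : seq (word bool) := reduced_words 3.

Fixpoint all_words (n : nat) : seq (word bool) :=
  if n is n'.+1 then [::] :: [seq a :: w | a <- letters, w <- all_words n'] else [:: [::]].

Lemma mem_all_words n w : (size w <= n)%N -> w \in all_words n.
Proof.
elim: n w => [|n IH] [|a w] // sw; rewrite /all_words -/all_words inE.
apply/orP; right; apply/allpairsP; exists (a, w); split=> //; last exact: IH.
by case: a {sw} => [[] []].
Qed.

Lemma ball3P w : (size w <= 3)%N -> exists2 u, u \in ball3 & wclass w = wclass u.
Proof.
move=> /mem_all_words w3.
have /allP/(_ _ w3)/hasP [u u3 /nfP e] :
  all (fun w => has (fun u => nf w == nf u) ball3) (all_words 3) by vm_compute.
by exists u.
Qed.

(** No two reduced words of length at most 3 are identified in $G_3$, so [ball3] lists the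
    $1+4+12+36=53$ elements of $B(3)$ without repetition. *)
Lemma uniq_nf_ball3 : uniq (map nf ball3). Proof. by vm_compute. Qed.

Implicit Types A B : word bool -> bool.

Definition conv A B (k : word bool) : bool :=
  \big[addb/false]_(u <- ball3) \big[addb/false]_(v <- ball3)
    [&& nf (u ++ v) == nf k, A u & B v].

(** The last two clauses say that $A$ and $B$ each contain at least two words of [ball3], which is
    what nontriviality of a unit gives. *)
Definition inverse_pair A B : Prop :=
  [/\ forall k, conv A B k = (nf k == norigin),
      forall k, conv B A k = (nf k == norigin),
      forall u, exists v, [/\ v \in ball3, v != u & A v]
    & forall u, exists v, [/\ v \in ball3, v != u & B v]].

Lemma inverse_pairC A B : inverse_pair A B -> inverse_pair B A.
Proof. by case. Qed.

(** The quantification over all pairs lets every symmetry of inverse pairs act on excluded words. *)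
Definition excluded w : Prop := forall A B, inverse_pair A B -> ~~ A w.

Lemma big_ball3_reindex f (F : word bool -> bool) : perm_eq (map f ball3) ball3 ->
  \big[addb/false]_(u <- ball3) F (f u) = \big[addb/false]_(u <- ball3) F u.
Proof. by move=> fb; rewrite -[RHS](perm_big _ fb) big_map. Qed.

Section Relabel.
Variable f : bool * bool -> bool * bool.
Hypothesis fK : involutive f.
Hypothesis fV : forall a, f (letter_inv a) = letter_inv (f a).
Hypothesis frel : all (fun r => nf (map f r) == norigin) G3_relators.
Hypothesis fball : perm_eq (map (map f) ball3) ball3.

Let equiv_map u v : word_equiv G3_relators u v -> wclass (map f u) = wclass (map f v).
Proof.
elim=> {u v} [//|u v _ -> //|u v w _ -> _ -> //|u v a|u v r rr].
  rewrite !map_cat /= fV; apply/word_classP; exact: (WordCancel _ _ _ (f a)).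
rewrite !map_cat !word_classM.
by rewrite (elimT (nfP _ [::]) (allP frel _ rr)) word_class1 mul1g.
Qed.

Let nf_map u v : (nf (map f u) == nf (map f v)) = (nf u == nf v).
Proof.
apply/nfP/nfP => /word_classP /equiv_map //.
by rewrite -!map_comp !(eq_map (g := id)) ?map_id.
Qed.

Let conv_map A B k : conv (A \o map f) (B \o map f) k = conv A B (map f k).
Proof.
rewrite /conv -[RHS](big_ball3_reindex _ fball); apply: eq_bigr => u _.
rewrite -[RHS](big_ball3_reindex _ fball); apply: eq_bigr => v _.
by rewrite -map_cat nf_map.
Qed.

Lemma inverse_pair_map A B :
  inverse_pair A B -> inverse_pair (A \o map f) (B \o map f).
Proof.
have mapK : involutive (map f) by apply: mapK.
have nt A' : (forall u, exists v, [/\ v \in ball3, v != u & A' v]) ->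
    forall u, exists v, [/\ v \in ball3, v != u & (A' \o map f) v].
  move=> nA u; have [v [v3 vu Av]] := nA (map f u).
  exists (map f v); split; last by rewrite /= mapK.
    by rewrite -(perm_mem fball) map_f.
  by apply: contraNneq vu => <-; rewrite mapK.
have nf0 k : (nf (map f k) == norigin) = (nf k == norigin) by exact: (nf_map k [::]).
by case=> h1 h2 n1 n2; split; try exact: nt; move=> k; rewrite conv_map ?h1 ?h2 nf0.
Qed.

(** If $A$ contained the image of [w], the pulled back pair would contain [w]. *)
Lemma excluded_map w : excluded w -> excluded (map f w).
Proof. by move=> ew A B /inverse_pair_map /ew. Qed.

End Relabel.

Lemma uniq_map_inj (T1 T2 : eqType) (f : T1 -> T2) (s : seq T1) :
  uniq (map f s) -> {in s &, injective f}.
Proof.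
elim: s => [|w s IH] //= /andP [ws us] u v.
rewrite !inE => /predU1P [->|su] /predU1P [->|sv] // e; last exact: IH.
  by rewrite e map_f in ws.
by rewrite -e map_f in ws.
Qed.

Lemma nf_word_inv u v : (nf (word_inv u) == nf (word_inv v)) = (nf u == nf v).
Proof.
by apply/nfP/nfP; rewrite !word_classV; [apply: invg_inj | move->].
Qed.

Lemma ball3_inv : perm_eq (map (@word_inv bool) ball3) ball3.
Proof. by vm_compute. Qed.

(** Inversion reverses products, so it exchanges the two families of equations in [inverse_pair]. *)
Lemma conv_inv A B k :
  conv (A \o @word_inv bool) (B \o @word_inv bool) k = conv B A (word_inv k).
Proof.
rewrite /conv exchange_big -[RHS](big_ball3_reindex _ ball3_inv).
apply: eq_bigr => v _; rewrite -[RHS](big_ball3_reindex _ ball3_inv).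
by apply: eq_bigr => u _; rewrite -word_inv_cat nf_word_inv [A _ && _]andbC.
Qed.

Lemma inverse_pair_inv A B : inverse_pair A B ->
  inverse_pair (A \o @word_inv bool) (B \o @word_inv bool).
Proof.
have invK := @word_invK bool.
have nt A' : (forall u, exists v, [/\ v \in ball3, v != u & A' v]) ->
    forall u, exists v, [/\ v \in ball3, v != u & (A' \o @word_inv bool) v].
  move=> nA u; have [v [v3 vu Av]] := nA (word_inv u).
  exists (word_inv v); split; last by rewrite /= invK.
    by rewrite -(perm_mem ball3_inv) map_f.
  by apply: contraNneq vu => <-; rewrite invK.
have nf0 k : (nf (word_inv k) == norigin) = (nf k == norigin).
  exact: (nf_word_inv k [::]).
by case=> h1 h2 n1 n2; split; try exact: nt; move=> k; rewrite conv_inv ?h1 ?h2 nf0.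
Qed.

Lemma excluded_inv w : excluded w -> excluded (word_inv w).
Proof. by move=> ew A B /inverse_pair_inv /ew. Qed.

Lemma excludedC w A B : excluded w -> inverse_pair A B -> ~~ A w && ~~ B w.
Proof. by move=> ew h; rewrite (ew _ _ h) (ew _ _ (inverse_pairC h)). Qed.

Definition flip_x (a : bool * bool) := (a.1, a.2 (+) ~~ a.1).
Definition flip_y (a : bool * bool) := (a.1, a.2 (+) a.1).

(** Two sign changes and the exchange of generators yield the eight signed permutations; with
    inversion this makes 16 words, possibly repeated. *)
Definition word_orbit (w : word bool) : seq (word bool) :=
  let s1 := [:: w; word_inv w] in
  let s2 := s1 ++ map (map flip_x) s1 in
  let s3 := s2 ++ map (map flip_y) s2 in
  s3 ++ map (map swap_xy) s3.

Lemma excluded_orbit w v : excluded w -> v \in word_orbit w -> excluded v.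
Proof.
move=> ew.
have step s f : (forall u, u \in s -> excluded u) ->
    (forall u, excluded u -> excluded (f u)) ->
    forall u, u \in s ++ map f s -> excluded u.
  by move=> es ef u; rewrite mem_cat => /orP[/es//|/mapP[t /es /ef et ->]].
rewrite /word_orbit; set s1 := [:: w; _]; set s2 := s1 ++ _; set s3 := s2 ++ _.
have e1 u : u \in s1 -> excluded u.
  by rewrite !inE => /orP[] /eqP -> //; apply: excluded_inv.
have e2 : forall u, u \in s2 -> excluded u.
  apply: step => // u; apply: excluded_map; first [by vm_compute | by case=> [[] []]].
have e3 : forall u, u \in s3 -> excluded u.
  apply: step => // u; apply: excluded_map; first [by vm_compute | by case=> [[] []]].
move: v; apply: step => // u; apply: excluded_map; first [by vm_compute | by case=> [[] []]].
Qed.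

(** * From nontrivial units to inverse pairs *)

Section UnitSupports.
Local Open Scope ring_scope.

Definition support (a : group_ring 'F_2 G3) (w : word bool) : bool :=
  mcoeff (wclass w) a != 0.

Lemma ball_expansion a : supp_in_ball [:: G3x; G3y] 3 a ->
  a = \sum_(u <- ball3) << (support a u)%:R *g wclass u >>.
Proof.
move=> a3; apply/malgP => g; rewrite -[g]word_classK; move: (repr g) => k.
have e : mcoeff (wclass k) (\sum_(u <- ball3) << (support a u)%:R *g wclass u >>)
    = \sum_(u <- ball3 | nf u == nf k) mcoeff (wclass u) a.
  rewrite raddf_sum [RHS]big_mkcond; apply: eq_bigr => u _ /=; rewrite mcoeffU eq_wclass.
  by rewrite /support -F2_neq0; case: (_ == _).
rewrite e.
case: (boolP (nf k \in map nf ball3)) => [/mapP [u u3 ku]|kB].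
  rewrite ku -big_filter.
  have -> : [seq v <- ball3 | nf v == nf u] = [:: u].
    rewrite -(filter_pred1_uniq (map_uniq uniq_nf_ball3) u3).
    apply: eq_in_filter => v v3 /=; apply/eqP/eqP => [|-> //].
    exact: (uniq_map_inj uniq_nf_ball3).
  by rewrite big_seq1; congr (mcoeff _ a); apply/nfP; rewrite ku.
rewrite big_seq_cond big_pred0 => [|u].
  apply/eqP; rewrite mcoeff_eq0; apply: contra kB => /a3 /word_ballP [w /ball3P [u u3 wu] kw].
  by apply/mapP; exists u => //; apply/eqP/nfP; rewrite kw wu.
by apply: contraNF kB => /andP [u3 /eqP <-]; apply: map_f.
Qed.

Lemma mcoeff_mul_ball a b k :
  supp_in_ball [:: G3x; G3y] 3 a -> supp_in_ball [:: G3x; G3y] 3 b ->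
  mcoeff (wclass k) (a * b) = (conv (support a) (support b) k)%:R.
Proof.
move=> a3 b3; rewrite {1}(ball_expansion a3) {1}(ball_expansion b3).
rewrite [X in mcoeff _ X]gr_mul_suml raddf_sum /=.
under eq_bigr => u _.
  rewrite gr_mul_sumr raddf_sum /=.
  under eq_bigr => v _ do rewrite gr_mulUU -word_classM mcoeffU eq_wclass.
  over.
rewrite /conv -F2_natr_xor; apply: eq_bigr => u _.
rewrite -F2_natr_xor; apply: eq_bigr => v _.
by case: (_ == _); rewrite ?mulr1n ?mulr0n // -natrM mulnb.
Qed.

Lemma support_inverse_pair (a : group_ring 'F_2 G3) :
  nontrivial_unit a -> supp_in_ball [:: G3x; G3y] 3 a ->
  supp_in_ball [:: G3x; G3y] 3 a^-1 -> inverse_pair (support a) (support a^-1).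
Proof.
have nt (b : group_ring 'F_2 G3) : nontrivial_unit b ->
    supp_in_ball [:: G3x; G3y] 3 b ->
    forall u, exists v, [/\ v \in ball3, v != u & support b v].
  move=> [ub nb] b3 u.
  case: (boolP (has (fun v => (v != u) && support b v) ball3)) => [|/hasPn h].
    by case/hasP=> v v3 /andP [vu bv]; exists v.
  (* Now [u] is the only word that can be in the support. If it is, [b] is a group element;
     otherwise [b] is zero, which is not a unit. *)
  have b0 v : v \in ball3 -> v != u -> support b v = false.
    by move=> /h; case: (v != u) => //= /negbTE.
  case: (boolP ((u \in ball3) && support b u)) => [/andP [u3 bu]|bu].
    case: nb; exists (wclass u); rewrite {1}(ball_expansion b3).
    rewrite (bigD1_seq u) ?(map_uniq uniq_nf_ball3) //= bu big_seq_cond big1 ?addr0 //.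
    by move=> v /andP [v3 vu]; rewrite b0 ?monalgU0.
  move: ub; rewrite {1}(ball_expansion b3) big_seq big1 ?unitr0 // => v v3.
  case: (eqVneq v u) => [vu|vu]; last by rewrite b0 ?monalgU0.
  by move: bu; rewrite -vu v3 /= => /negbTE ->; rewrite monalgU0.
move=> nta a3 i3; have [ua na] := nta.
(* If $a^{-1}$ were the group element $g$, then $a$ would be $g^{-1}$. *)
have nti : nontrivial_unit a^-1.
  split=> [|[g e]]; first by rewrite unitrV.
  apply: na; exists g^-1%g.
  have gu : gr_of 'F_2 g * gr_of 'F_2 g^-1%g = 1 by rewrite [LHS]gr_mulUU mulr1 mulgV.
  by rewrite -[LHS]mulr1 -gu -e mulrA mulrV ?mul1r.
split; [move=> k | move=> k | exact: (nt a nta a3) | exact: (nt _ nti i3)].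
  by apply: F2_natr_inj; rewrite -mcoeff_mul_ball // -mcoeff_gr_one mulrV.
by apply: F2_natr_inj; rewrite -mcoeff_mul_ball // -mcoeff_gr_one mulVr.
Qed.

End UnitSupports.

(** * Refutation by unit propagation *)

Definition bword (i : nat) : word bool := nth [::] ball3 i.

Lemma ball3E : ball3 = map bword (iota 0 53).
Proof. by rewrite -[LHS](mkseq_nth [::]). Qed.

Definition constraint : Type := (bool * seq (nat * nat))%type.

Definition constraint_holds A B (c : constraint) : Prop :=
  \big[addb/false]_(p <- c.2) (A (bword p.1) && B (bword p.2)) = c.1.

Definition int_eqb (m n : int) : bool :=
  match m, n with
  | Posz m', Posz n' | Negz m', Negz n' => m' == n'
  | _, _ => false
  end.

(* Call-by-value evaluation of [&&] would compare all four components. *)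
Definition nform_eqb (g h : nform) : bool :=
  let: (i, j, k, t) := g in let: (i', j', k', t') := h in
  if int_eqb k k' then if int_eqb i i' then if int_eqb j j' then t == t'
  else false else false else false.

Lemma int_eqbE m n : int_eqb m n = (m == n).
Proof. by case: m n => [m|m] [n|n]. Qed.

Lemma nform_eqbE g h : nform_eqb g h = (g == h).
Proof.
case: g h => [[[i j] k] t] [[[i' j'] k'] t'] /=; rewrite !int_eqbE !xpair_eqE.
by case: (k == k'); case: (i == i'); case: (j == j'); rewrite ?andbF.
Qed.

(** [n] is fuel. Running out of it would lose equations but would not make any of the listed ones
    false. *)
Fixpoint group_by_product (n : nat) (s : seq (nform * (nat * nat))) : seq constraint :=
  if n is n'.+1 then
    if s is (k, _) :: _ then
      (k == norigin, [seq q.2 | q <- [seq q <- s | nform_eqb q.1 k]])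
        :: group_by_product n' [seq q <- s | ~~ nform_eqb q.1 k]
    else [::]
  else [::].

Definition products_AB : seq (nform * (nat * nat)) :=
  [seq (nf (bword i ++ bword j), (i, j)) | i <- iota 0 53, j <- iota 0 53].

(** The index into $A$ still comes first in each pair, so that both families give constraints of one
    format. *)
Definition products_BA : seq (nform * (nat * nat)) :=
  [seq (nf (bword j ++ bword i), (i, j)) | j <- iota 0 53, i <- iota 0 53].

Definition constraints : seq constraint :=
  group_by_product (53 * 53) products_AB ++ group_by_product (53 * 53) products_BA.

(** Removing the pairs with product [k] does not change the sum over any other product, so the
    hypothesis passes to the recursive call. *)
Lemma group_by_product_holds A B n s :
  (forall q, q \in s -> \big[addb/false]_(p <- s | p.1 == q.1)
      (A (bword p.2.1) && B (bword p.2.2)) = (q.1 == norigin)) ->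
  forall c, c \in group_by_product n s -> constraint_holds A B c.
Proof.
elim: n s => [|n IH] [|[k p] s] // hs c; rewrite /group_by_product -/group_by_product inE.
have := hs (k, p) (mem_head _ _).
move: ((k, p) :: s) hs => t hs kt; case/predU1P=> [->|].
  rewrite /constraint_holds /= big_map big_filter -kt.
  by apply: eq_bigl => q; rewrite nform_eqbE.
apply: IH => q; rewrite mem_filter nform_eqbE => /andP [qk qs].
rewrite big_filter_cond -(hs q qs); apply: eq_bigl => r.
by rewrite nform_eqbE andbC; case: eqP => // ->.
Qed.

Lemma constraints_hold A B : inverse_pair A B ->
  forall c, c \in constraints -> constraint_holds A B c.
Proof.
case=> hAB hBA _ _ c; rewrite mem_cat => /orP[]; apply: group_by_product_holds => q.
  case/allpairsP=> -[i j] [_ _ ->] /=; rewrite -hAB /conv ball3E big_mkcond.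
  rewrite big_allpairs_dep big_map; apply: eq_bigr => i' _.
  by rewrite big_map; apply: eq_bigr => j' _ /=; case: (_ == _).
case/allpairsP=> -[j i] [_ _ ->] /=; rewrite -hBA /conv ball3E big_mkcond.
rewrite big_allpairs_dep big_map; apply: eq_bigr => j' _.
by rewrite big_map; apply: eq_bigr => i' _ /=; rewrite andbC; case: (_ == _).
Qed.

(** Values of $A$ and of $B$ on the words of [ball3], by index; [None] means undetermined, also
    beyond the end of a list. *)
Definition partial : Type := (seq (option bool) * seq (option bool))%type.

Definition agree A (s : seq (option bool)) : Prop :=
  forall i b, nth None s i = Some b -> A (bword i) = b.

Lemma agree_set A s i : agree A s -> agree A (set_nth None s i (Some (A (bword i)))).
Proof.
by move=> h j b; rewrite nth_set_nth /=; case: eqP => [-> [] | _ /h].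
Qed.

(* [u] is the only pair found so far whose value is not determined; [r] is the
   parity that the remaining pairs must sum to. *)
Fixpoint scan (s : partial) (r : bool) (u : option (nat * nat)) (ps : seq (nat * nat))
    : option partial :=
  match ps with
  | [::] =>
    match u with
    | None => if r then None else Some s
    | Some (i, j) =>
      if r then Some (set_nth None s.1 i (Some true), set_nth None s.2 j (Some true))
      else if nth None s.1 i == Some true then Some (s.1, set_nth None s.2 j (Some false))
      else if nth None s.2 j == Some true then Some (set_nth None s.1 i (Some false), s.2)
      else Some s
    end
  | (i, j) :: ps' =>
    match nth None s.1 i, nth None s.2 j with
    | Some false, _ | _, Some false => scan s r u ps'
    | Some true, Some true => scan s (~~ r) u ps'
    | _, _ => if u is Some _ then Some s else scan s r (Some (i, j)) ps'
    end
  end.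

Definition sound A B (s : option partial) : Prop :=
  if s is Some (a, b) then agree A a /\ agree B b else False.

(** Invariant of the scan: the value of the pending pair [u] and those of the pairs still to be read
    sum to [r]. *)
Lemma scan_sound A B s r u ps : sound A B (Some s) ->
  (if u is Some (i, j) then A (bword i) && B (bword j) else false) (+)
    \big[addb/false]_(p <- ps) (A (bword p.1) && B (bword p.2)) = r ->
  sound A B (scan s r u ps).
Proof.
case: s => a b [Aa Bb]; elim: ps r u => [|[i j] ps IH] r u.
  rewrite big_nil addbF; case: u => [[i j]|] /= <-; last by [].
  have := agree_set (i := i) Aa; have := agree_set (i := j) Bb.
  case Ai: (A (bword i)); case Bj: (B (bword j)) => //= Bb' Aa'.
  - case: eqP => // _; case: eqP => [/Bb|_ //]; by rewrite Bj.
  - case: eqP => [/Aa|_]; first by rewrite Ai.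
    by case: eqP.
  - case: eqP => [/Aa|_]; first by rewrite Ai.
    by case: eqP => [/Bb|_ //]; rewrite Bj.
rewrite big_cons /=.
case ei: (nth None a i) => [[]|]; case ej: (nth None b j) => [[]|] h;
  try by apply: IH; rewrite -h ?(Aa _ _ ei) ?(Bb _ _ ej) ?andbF.
- by apply: IH; rewrite -h (Aa _ _ ei) (Bb _ _ ej) /= addbN negbK.
- by case: u h => [[i' j']|] h //; apply: IH; rewrite -h.
- by case: u h => [[i' j']|] h //; apply: IH; rewrite -h.
- by case: u h => [[i' j']|] h //; apply: IH; rewrite -h.
Qed.

(* Nontriviality of a unit only enters through this test. *)
Definition too_few (s : seq (option bool)) : bool :=
  (count (fun i => nth None s i != Some false) (iota 0 53) <= 1)%N.

Fixpoint sweep (cs : seq constraint) (s : partial) : option partial :=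
  if cs is c :: cs' then obind (sweep cs') (scan s c.1 None c.2) else Some s.

Fixpoint propagate (cs : seq constraint) (n : nat) (s : partial) : option partial :=
  if n is n'.+1 then
    if too_few s.1 || too_few s.2 then None
    else obind (propagate cs n') (sweep cs s)
  else Some s.

Definition assign (s : partial) (l : bool * nat) (v : bool) : partial :=
  if l.1 then (s.1, set_nth None s.2 l.2 (Some v))
  else (set_nth None s.1 l.2 (Some v), s.2).

(* A literal [(false, i)] or [(true, i)] of the certificate claims that assuming the
   [i]-th word of [ball3] to be in [A], respectively in [B], is refuted by
   propagation alone. *)
Fixpoint refute (cs : seq constraint) (s : partial) (ls : seq (bool * nat)) : bool :=
  if ls is l :: ls' then
    ~~ isSome (propagate cs 10 (assign s l true)) &&
    (if propagate cs 1 (assign s l false) is Some s' then refute cs s' ls' else true)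
  else ~~ isSome (propagate cs 10 s).

(** Excluded words are set to false on both sides, because exchanging $A$ and $B$ preserves inverse
    pairs; only [w] is assumed to be in $A$. *)
Definition initial (zeros : seq (word bool)) (w : word bool) : partial :=
  let s := [seq if u \in zeros then Some false else None | u <- ball3] in
  (set_nth None s (index w ball3) (Some true), s).

(** A rejected step ends the run with the words excluded so far, so the output is sound for every
    certificate. *)
Fixpoint exclude (cs : seq constraint) (zeros : seq (word bool))
    (steps : seq (word bool * seq (bool * nat))) : seq (word bool) :=
  if steps is (w, ls) :: steps' then
    if (w \in ball3) && refute cs (initial zeros w) ls
    then exclude cs (word_orbit w ++ zeros) steps'
    else zeros
  else zeros.

(** The seven words represent the orbits of the nonempty words of [ball3]. Each refutation uses the
    orbits excluded before it; in the last four, propagation needs no case distinction. *)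
Definition certificate : seq (word bool * seq (bool * nat)) :=
  let x := (false, false) in let X := (false, true) in
  let y := (true, false) in let Y := (true, true) in
  [:: ([:: x; x; y],
       [:: (true, 11); (false, 29); (true, 50); (false, 22); (true, 5); (true, 44);
           (true, 8); (false, 3); (true, 25); (true, 47); (true, 27); (true, 7);
           (false, 43); (true, 30); (true, 14)]);
      ([:: x; y; X],
       [:: (true, 25); (false, 6); (true, 32); (true, 34); (true, 14); (true, 30);
           (true, 1)]);
      ([:: x; y; x],
       [:: (true, 6); (true, 28); (true, 41); (false, 45); (true, 32); (false, 52);
           (false, 19); (false, 49); (true, 44); (false, 6); (true, 36); (false, 34)]);
      ([:: x; x; x], [::]); ([:: x; x], [::]); ([:: x; y], [::]); ([:: x], [::])].

Definition all_but_one (zeros : seq (word bool)) : bool :=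
  all (fun u => (u == [::]) || (u \in zeros)) ball3.

Lemma all_but_oneP zeros w :
  all_but_one zeros -> w \in ball3 -> w != [::] -> w \in zeros.
Proof. by move=> /allP h w3 w1; have := h w w3; rewrite (negbTE w1). Qed.

Lemma certificate_checks : all_but_one (exclude constraints [::] certificate).
Proof. by vm_compute. Qed.

(** * Soundness of the refutation *)

Lemma not_too_few A s : agree A s ->
  (forall u, exists v, [/\ v \in ball3, v != u & A v]) -> ~~ too_few s.
Proof.
move=> As nA; have [v [v3 _ Av]] := nA [::]; have [w [w3 wv Aw]] := nA v.
rewrite -ltnNge -size_filter.
have mem_index u : u \in ball3 -> A u ->
    index u ball3 \in [seq i <- iota 0 53 | nth None s i != Some false].
  move=> u3 Au; have i53 : (index u ball3 < size ball3)%N by rewrite index_mem.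
  rewrite mem_filter mem_iota; apply/andP; split; last exact: i53.
  by apply/eqP => /As; rewrite /bword nth_index // Au.
apply: (@uniq_leq_size _ [:: index v ball3; index w ball3]).
  rewrite cons_uniq mem_seq1 andbT; apply: contra wv => /eqP e.
  by rewrite -(nth_index [::] v3) e nth_index.
by move=> i; rewrite !inE => /orP[] /eqP ->; apply: mem_index.
Qed.

Lemma agree_assign A s i v : agree A s -> A (bword i) = v ->
  agree A (set_nth None s i (Some v)).
Proof. by move=> As <-; apply: agree_set. Qed.

Section Soundness.
Variables (A B : word bool -> bool).
Hypothesis AB : inverse_pair A B.

Lemma sweep_sound cs s : {subset cs <= constraints} -> sound A B (Some s) ->
  sound A B (sweep cs s).
Proof.
elim: cs s => [|c cs IH] s //= sub As.
have := scan_sound (u := None) As (constraints_hold AB (sub c (mem_head _ _))).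
by case: scan => //= s'; apply: IH => d dc; apply: sub; rewrite inE dc orbT.
Qed.

Lemma propagate_sound cs n s : {subset cs <= constraints} -> sound A B (Some s) ->
  sound A B (propagate cs n s).
Proof.
move=> sub; elim: n s => [|n IH] s //= As; case: ifP => [few|_].
  case: s As few => a b /= [Aa Bb]; have [_ _ nA nB] := AB.
  by rewrite (negbTE (not_too_few Aa nA)) (negbTE (not_too_few Bb nB)).
by have := sweep_sound sub As; case: sweep => //=.
Qed.

Lemma assign_sound s l v : sound A B (Some s) ->
  (if l.1 then B (bword l.2) else A (bword l.2)) = v ->
  sound A B (Some (assign s l v)).
Proof.
by case: s l => a b [[] i] [Aa Bb] h; split=> //=; apply: agree_assign.
Qed.

Lemma refute_sound cs s ls : {subset cs <= constraints} -> refute cs s ls ->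
  ~ sound A B (Some s).
Proof.
move=> sub; elim: ls s => [|l ls IH] s; rewrite /refute -/refute.
  by move=> np As; have := propagate_sound 10 sub As; case: (propagate _ _ _) np.
case/andP=> np h As.
case v: (if l.1 then B (bword l.2) else A (bword l.2)).
  by have := propagate_sound 10 sub (assign_sound As v); case: (propagate _ _ _) np.
have := propagate_sound 1 sub (assign_sound As v).
by case: (propagate _ _ _) h => // s' /IH.
Qed.

Lemma initial_sound zeros w : (forall u, u \in zeros -> excluded u) ->
  w \in ball3 -> A w -> sound A B (Some (initial zeros w)).
Proof.
move=> ez w3 Aw.
have zero A' : (forall u, u \in zeros -> ~~ A' u) ->
    agree A' [seq if u \in zeros then Some false else None | u <- ball3].
  move=> zA i v; case: (ltnP i 53) => i53; last by rewrite nth_default // size_map.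
  rewrite (nth_map [::]) //; case: ifP => // uz [<-]; exact/negbTE/zA.
have ezAB u : u \in zeros -> ~~ A u && ~~ B u by move/ez/excludedC; apply.
split; last by apply: zero => u /ezAB /andP [].
apply: agree_assign; last by rewrite /bword nth_index.
by apply: zero => u /ezAB /andP [].
Qed.

End Soundness.

Lemma exclude_sound cs zeros steps : {subset cs <= constraints} ->
  (forall u, u \in zeros -> excluded u) ->
  forall u, u \in exclude cs zeros steps -> excluded u.
Proof.
move=> sub; elim: steps zeros => [|[w ls] steps IH] zeros ez //; rewrite /exclude -/exclude.
case: ifP => // /andP [w3 r]; apply: IH => u; rewrite mem_cat => /orP[|/ez //].
apply: excluded_orbit => A B AB; apply/negP => Aw.
exact: (refute_sound AB sub r (initial_sound AB ez w3 Aw)).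
Qed.

(** Having at least two elements, $A$ contains a word other than the empty one, but the certificate
    excludes all of these. *)
Lemma no_inverse_pair A B : ~ inverse_pair A B.
Proof.
move=> AB; have [_ _ nA _] := AB; have [v [v3 v1 Av]] := nA [::].
have ev : excluded v.
  by apply: (exclude_sound (zeros := [::])) (all_but_oneP certificate_checks v3 v1).
by move: (ev _ _ AB); rewrite Av.
Qed.

(** * The localization radius *)

Local Open Scope ring_scope.

Lemma word_ballW r s g : (r <= s)%N ->
  word_ball [:: G3x; G3y] r g -> word_ball [:: G3x; G3y] s g.
Proof. by move=> rs [w [wr ? ?]]; exists w; split=> //; apply: leq_trans rs. Qed.

Theorem proposition5p3 :
  (exists alpha : group_ring 'F_2 G3,
     [/\ nontrivial_unit alpha,
         supp_in_ball [:: G3x; G3y] 4 alpha,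
         supp_in_ball [:: G3x; G3y] 4 alpha^-1
       & (#|` supp alpha| + #|` supp alpha^-1|)%N = 58%N])
  /\ is_unit_localization_radius [:: G3x; G3y] 4.
Proof.
split; first exact: exists_unit.
split=> [|r [a [na ar ir]]].
  by have [a [na a4 i4 _]] := exists_unit; exists a.
(* A radius below 4 may be enlarged to 3, where the two supports would form an inverse pair. *)
rewrite leqNgt; apply/negP; rewrite ltnS => r3.
apply: (@no_inverse_pair (support a) (support a^-1)); apply: support_inverse_pair => //.
  by move=> g /ar; apply: word_ballW.
by move=> g /ir; apply: word_ballW.
Qed.
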